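(* Let $\sigma\in\{132\text{-}4,\ 142\text{-}3\}$. Define $F_1(z,x)=zx+\sum_{n\ge2}\sum_{\pi\in\mathcal{S}_n(\sigma),\,\pi_1>\pi_2} z^n x^{\pi_1}$ and $F_2(z,x)=\sum_{n\ge2}\sum_{\pi\in\mathcal{S}_n(\sigma),\,\pi_1<\pi_2} z^n x^{\pi_1}$. Define linear operators on $\mathbb{Q}[[z,x]]$ by their action on monomials (extended linearly): $P_{21}: z^n x^b\mapsto \sum_{a=b+1}^{n+1} z^{n+1}x^a$; $P_{123}: z^n x^b\mapsto \sum_{a=1}^{b} z^{n+1}x^a$; $P_{231}: z^n x^c\mapsto \sum_{a=c+1}^{n+1}\sum_{b=a+1}^{n+2} z^{n+2}x^a$; $P_{132}: z^n x^c\mapsto \sum_{a=1}^{c} z^{n+2}x^a$. Then $F_1(z,x)=zx+P_{21}\circ F_1(z,x)$ and $F_2(z,x)=z^2x+P_{132}\circ F_1(z,x)+P_{231}\circ F_1(z,x)+P_{123}\circ F_2(z,x)$.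
   Context: A vincular pattern is a permutation $\rho\in\mathcal{S}_m$ written with dashes between some consecutive entries; $\pi\in\mathcal{S}_n$ contains it if there are indices $i_1<\cdots<i_m$ with $\pi_{i_1}\cdots\pi_{i_m}$ order-isomorphic to $\rho$ and $i_{j+1}=i_j+1$ whenever $\rho_j,\rho_{j+1}$ are not separated by a dash; otherwise $\pi$ avoids it. $\mathcal{S}_n(\rho)$ is the set of $\rho$-avoiding permutations in $\mathcal{S}_n$.
   Formalization: P_21, P_132 and P_231 are applied to F_1+F_2 instead of F_1, since the printed equations fail (at z^3 and z^4); series are taken in Q[x][[z]], as P_123 and P_132 are not defined on all of Q[[z,x]]. *)

(* Defs.v *)
From HB Require Import structures.
From mathcomp Require Import all_boot all_order all_algebra all_fingroup.

Set Implicit Arguments.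
Unset Strict Implicit.
Unset Printing Implicit Defensive.

Import GRing.Theory.
Local Open Scope ring_scope.

(* A vincular pattern is stored as its list of maximal dash-free blocks:
   [:: [:: 1; 3; 2]; [:: 4]] is 132-4. *)
Record vincular := Vincular {
  blocks : seq (seq nat);
  blocks_perm : ([::] \notin blocks)
             && perm_eq (flatten blocks) (iota 1 (size (flatten blocks))) }.

Definition pat_word (s : vincular) : seq nat := flatten (blocks s).
Definition pat_size (s : vincular) : nat := size (pat_word s).

Definition same_block (s : vincular) (j k : nat) : bool :=
  reshape_index (shape (blocks s)) j == reshape_index (shape (blocks s)) k.

Definition occurrence (n : nat) (s : vincular) (p : 'S_n)
    (i : {ffun 'I_(pat_size s) -> 'I_n}) : bool :=
  let m := pat_size s in
  let r := nth 0%N (pat_word s) in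
  [&& [forall j : 'I_m, forall k : 'I_m, (j < k)%N ==> (i j < i k)%N],
      [forall j : 'I_m, forall k : 'I_m, (p (i j) < p (i k))%N == (r j < r k)%N]
    & [forall j : 'I_m, forall k : 'I_m,
         (k == j.+1 :> nat) && same_block s j k ==> (i k == (i j).+1 :> nat)]].

Definition contains (n : nat) (s : vincular) (p : 'S_n) : bool :=
  [exists i : {ffun 'I_(pat_size s) -> 'I_n}, occurrence p i].

Definition Av (n : nat) (s : vincular) : {set 'S_n} :=
  [set p : 'S_n | ~~ contains s p].

Definition v132_4 : vincular := @Vincular [:: [:: 1; 3; 2]; [:: 4]]%N isT.
Definition v142_3 : vincular := @Vincular [:: [:: 1; 4; 2]; [:: 3]]%N isT.

(* 'S_n permutes {0, ..., n-1}; the letters of the word of p are shifted by 1. *)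
Definition letter1 (n : nat) (p : 'S_n.+2) : nat := (p ord0).+1.
Definition letter2 (n : nat) (p : 'S_n.+2) : nat := (p (inord 1)).+1.

(* Q[x][[z]], viewed inside Q[[z,x]]: f n is the coefficient of z^n.  On series
   outside this subspace, such as the sum of all x^b, the linear extensions of
   P123 and P132 below would have infinite coefficients. *)
Definition zxseries := nat -> {poly rat}.

Definition zx_mon (n b : nat) : zxseries := fun N => 'X^b *+ (N == n).

(* The (z-adically continuous) linear operator with
   z^n x^b |-> z^(n+k) * q n b. *)
Definition mon_extend (k : nat) (q : nat -> nat -> {poly rat}) (f : zxseries) :
    zxseries :=
  fun N => if (k <= N)%N then
             \sum_(b < size (f (N - k)%N)) (f (N - k)%N)`_b *: q (N - k)%N b
           else 0.

Definition P21 : zxseries -> zxseries :=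
  mon_extend 1 (fun n b => \sum_(b.+1 <= a < n.+2) 'X^a).
Definition P123 : zxseries -> zxseries :=
  mon_extend 1 (fun n b => \sum_(1 <= a < b.+1) 'X^a).
Definition P231 : zxseries -> zxseries :=
  mon_extend 2 (fun n c => \sum_(c.+1 <= a < n.+2) \sum_(a.+1 <= b < n.+3) 'X^a).
Definition P132 : zxseries -> zxseries :=
  mon_extend 2 (fun n c => \sum_(1 <= a < c.+1) 'X^a).

Definition F1 (s : vincular) : zxseries :=
  zx_mon 1 1 \+ (fun n => if n is m.+2 then
    \sum_(p in Av m.+2 s | (letter1 p > letter2 p)%N) 'X^(letter1 p) else 0).

Definition F2 (s : vincular) : zxseries :=
  fun n => if n is m.+2 then
    \sum_(p in Av m.+2 s | (letter1 p < letter2 p)%N) 'X^(letter1 p) else 0.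

(* The generating function of all nonempty s-avoiders, z marking the size and
   x the first letter. *)
Definition F (s : vincular) : zxseries := F1 s \+ F2 s.

(* Main.v *)
Require Import Defs.
From mathcomp Require Import all_boot all_order all_algebra all_fingroup.
From mathcomp Require Import zify.

(* Delete the first letter a of a word p.  An occurrence of either pattern that
   uses a must begin with the first three letters of p, which then form 132.
   Hence prepending a to an avoider q creates no occurrence when the new word
   starts with a descent (P21), or with two ascents (P123), or with 231 (P231).
   When it starts with 132, the second letter must be the maximum (for 132-4) or
   the successor of the third letter (for 142-3); either way it is determined by
   the other letters, and deleting the first two letters gives P132. *)

Set Implicit Arguments.
Unset Strict Implicit.
Unset Printing Implicit Defensive.

Import GRing.Theory.
Local Open Scope ring_scope.

(** * Permutations as a first letter followed by a shorter permutation *)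

Lemma lift_perm_inj n (a b : 'I_n.+1) (q r : 'S_n) :
  lift_perm ord0 a q = lift_perm ord0 b r -> a = b /\ q = r.
Proof.
move=> eq_ab; have eab: a = b.
  by rewrite -[a](lift_perm_id ord0 a q) eq_ab lift_perm_id.
split=> //; apply/permP=> k; apply: (@lift_inj _ a).
by rewrite -(lift_perm_lift ord0) eq_ab lift_perm_lift eab.
Qed.

Lemma lift_perm_bij n :
  bijective (fun u : 'S_n * 'I_n.+1 => lift_perm ord0 u.2 u.1).
Proof.
apply: inj_card_bij => [[q a] [r b] /= /lift_perm_inj[-> ->] //|].
by rewrite card_prod !card_Sn card_ord factS mulnC.
Qed.

Lemma big_lift_perm (V : nmodType) n (P : pred 'S_n.+1) (f : 'S_n.+1 -> V) :
  \sum_(p | P p) f p =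
  \sum_q \sum_(a | P (lift_perm ord0 a q)) f (lift_perm ord0 a q).
Proof.
rewrite (reindex _ (onW_bij _ (lift_perm_bij n))) /=.
by rewrite (pair_big_dep xpredT (fun q a => P (lift_perm ord0 a q))
  (fun q a => f (lift_perm ord0 a q))).
Qed.

Lemma inord1 n : inord 1 = lift ord0 ord0 :> 'I_n.+2.
Proof. by apply: val_inj; rewrite /= inordK. Qed.

Lemma inord2 n : inord 2 = lift ord0 (lift ord0 ord0) :> 'I_n.+3.
Proof. by apply: val_inj; rewrite /= inordK. Qed.

Definition starts n (s : vincular) (p : 'S_n) : bool :=
  [exists i : {ffun 'I_(pat_size s) -> 'I_n},
     occurrence p i && [exists j, i j == 0%N :> nat]].

Lemma ltn_lift n (a : 'I_n.+1) (i j : 'I_n) :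
  (lift a i < lift a j)%N = (i < j)%N.
Proof. by rewrite /= /bump; lia. Qed.

(** An occurrence that misses position 0 already lies in [q]: inserting the value [a] preserves
    order, and moving all positions by one preserves adjacency. *)
Lemma contains_lift_perm n s (a : 'I_n.+1) (q : 'S_n) :
  contains s (lift_perm ord0 a q) =
  contains s q || starts s (lift_perm ord0 a q).
Proof.
have occ_lift (i : {ffun 'I_(pat_size s) -> 'I_n}) :
    occurrence (lift_perm ord0 a q) [ffun j => lift ord0 (i j)] = occurrence q i.
  rewrite /occurrence; congr [&& _, _ & _]; apply: eq_forallb => j;
    apply: eq_forallb => k; rewrite !ffunE //.
  by rewrite !lift_perm_lift ltn_lift.
apply/idP/idP.
- case/existsP=> i occ; have [i0|] := boolP [exists j, i j == 0%N :> nat].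
    by apply/orP; right; apply/existsP; exists i; rewrite occ.
  rewrite negb_exists => /forallP i_neq0.
  apply/orP; left; apply/existsP.
  have /fin_all_exists[f fE] j : exists k, i j = lift ord0 k.
    by case: (unliftP ord0 (i j)) (i_neq0 j) => [k ->|->] // _; exists k.
  exists [ffun j => f j]; rewrite -occ_lift.
  by rewrite (_ : finfun _ = i) //; apply/ffunP=> j; rewrite !ffunE fE.
- case/orP=> /existsP[i].
    by rewrite -occ_lift => occ; apply/existsP; exists [ffun j => lift ord0 (i j)].
  by case/andP=> occ _; apply/existsP; exists i.
Qed.

Lemma Av_lift_perm n s (a : 'I_n.+1) (q : 'S_n) :
  (lift_perm ord0 a q \in Av n.+1 s) =
  (q \in Av n s) && ~~ starts s (lift_perm ord0 a q).
Proof. by rewrite !inE contains_lift_perm negb_or. Qed.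

(** Turns the coefficientwise definition of [mon_extend] into a sum over combinatorial objects:
    after exchanging sums, each [i] contributes only at the exponent [g i]. *)
Lemma polysum_linear_ext (I : finType) (A : pred I) (g : I -> nat)
    (h : nat -> {poly rat}) (P := \sum_(i | A i) 'X^(g i) : {poly rat}) :
  \sum_(b < size P) P`_b *: h b = \sum_(i | A i) h (g i).
Proof.
(* [M] exceeds every exponent, so each [g i] is an index of the extended sum; the coefficients added
   beyond [size P] are zero. *)
pose M := (size P + \sum_(i | A i) (g i).+1)%N.
have le_gM i : A i -> (g i < M)%N.
  by move=> Ai; rewrite /M (bigD1 i) //=; lia.
transitivity (\sum_(b < M) P`_b *: h b).
  rewrite -!(big_mkord xpredT (fun b => P`_b *: h b)) /=.
  rewrite (big_cat_nat (n := size P) (p := M)) ?leq_addr //=.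
  rewrite [X in _ + X]big_nat_cond [X in _ + X]big1 ?addr0 //.
  by move=> b /andP[/andP[le_b _] _]; rewrite nth_default ?scale0r.
rewrite /P; under eq_bigr do rewrite coef_sum scaler_suml.
rewrite exchange_big /=; apply: eq_bigr => i /le_gM lt_gM.
rewrite (bigD1 (Ordinal lt_gM)) //= coefXn eqxx scale1r big1 ?addr0 // => b.
by rewrite -val_eqE /= coefXn => /negPf->; rewrite scale0r.
Qed.

Lemma letter2_lift n (a : 'I_n.+2) (q : 'S_n.+1) :
  letter2 (lift_perm ord0 a q) = (bump a (q ord0)).+1.
Proof. by rewrite /letter2 inord1 lift_perm_lift. Qed.

Lemma letter1_lift n (a : 'I_n.+2) (q : 'S_n.+1) :
  letter1 (lift_perm ord0 a q) = a.+1.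
Proof. by rewrite /letter1 lift_perm_id. Qed.

(** * Occurrences of the two patterns that use the first letter *)

Lemma contains_size n s (p : 'S_n) : contains s p -> (pat_size s <= n)%N.
Proof.
case/existsP=> i /and3P[/forallP incr _ _].
rewrite -[pat_size s]card_ord -[n]card_ord; apply: (@leq_card _ _ i) => j k eq_ijk.
have ltF u v : i u = i v -> (u < v)%N = false.
  move=> eq_i; apply/negP => lt_uv; have /forallP/(_ v)/implyP/(_ lt_uv) := incr u.
  by rewrite eq_i ltnn.
by apply: val_inj; move: (ltF _ _ eq_ijk) (ltF _ _ (esym eq_ijk)) => /=; lia.
Qed.

(* An occurrence at the positions 0, 1, 2, l. *)
Definition occ4 n s (p : 'S_n.+3) (l : 'I_n.+3) : bool :=
  [&& (2 < l)%N, (p ord0 < p (inord 2))%N, (p (inord 2) < p (inord 1))%N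
    & if blocks s == blocks v132_4 then (p (inord 1) < p l)%N
      else (p (inord 2) < p l < p (inord 1))%N].

(** Positions increase, so position 0 is taken by the first entry; the dash-free block of length
    three then forces positions 1 and 2, and only the last position is free. *)
Lemma starts_occ4 n s (p : 'S_n.+3) : s = v132_4 \/ s = v142_3 ->
  starts s p = [exists l, occ4 s p l].
Proof.
move=> hs; have i1 : (inord 1 : 'I_n.+3) = 1%N :> nat by apply: inordK.
have i2 : (inord 2 : 'I_n.+3) = 2 :> nat by apply: inordK.
apply/existsP/existsP.
- case=> i /andP[/and3P[/forallP incr /forallP ord /forallP adj] /existsP[j /eqP i0]].
  have lt4 k : (k < 4)%N -> (k < pat_size s)%N by case: hs => ->.
  pose o k (lt_k4 : (k < 4)%N) := Ordinal (lt4 k lt_k4).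
  have lt (u v : 'I_(pat_size s)) : (u < v)%N -> (i u < i v)%N
    by apply/implyP/(forallP (incr u)).
  have vals (u v : 'I_(pat_size s)) := eqP (forallP (ord u) v).
  have next (u v : 'I_(pat_size s)) :
      v = u.+1 :> nat -> same_block s u v -> i v = (i u).+1 :> nat.
    move=> uv buv; apply/eqP; apply: (implyP (forallP (adj u) v)).
    by rewrite buv andbT; apply/eqP.
  have e0 : i (@o 0%N isT) = ord0.
    apply: val_inj => /=.
    case: (ltnP 0 j) => [/(lt (@o 0%N isT))|]; first by rewrite i0.
    by rewrite leqn0 => /eqP j0; rewrite -[RHS]i0; congr (val (i _)); apply: val_inj.
  have e1 : i (@o 1%N isT) = inord 1.
    apply: ord_inj; rewrite i1 (next (@o 0%N isT)) // ?e0 //=.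
    by rewrite /same_block; case: hs => ->.
  have e2 : i (@o 2 isT) = inord 2.
    apply: ord_inj; rewrite i2 (next (@o 1%N isT)) // ?e1 ?i1 //=.
    by rewrite /same_block; case: hs => ->.
  have := lt (@o 2 isT) (@o 3 isT) isT; rewrite e2 i2 => lt2.
  exists (i (@o 3 isT)); rewrite /occ4 lt2 -e2 -e1 -e0 !vals /=.
  by case: (hs) => ->.
- case=> l; rewrite /occ4; case: hs => -> /and4P[/= l3 h1 h2 h3];
  exists [ffun j => nth ord0 [:: ord0; inord 1; inord 2; l] (val j)];
  rewrite /occurrence -!andbA; (apply/and4P; split);
  try (by apply/existsP; exists (@Ordinal 4 0 isT); rewrite ffunE);
  apply/forallP=> -[[|[|[|[|]]]] // ?]; apply/forallP=> -[[|[|[|[|]]]] // ?];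
  rewrite !ffunE /= ?i1 ?i2 //; lia.
Qed.

(* When r starts with c and c < b, the word a b c ... obtained from r by
   prepending first b and then a <= c avoids s only for b = peak s n c. *)
Definition peak s (n c : nat) : nat :=
  if blocks s == blocks v132_4 then n.+1 else c.+1.

(** The fourth letter may be chosen by value: the strict inequalities separate [v] from the first
    three letters, so its position is beyond 2. *)
Lemma starts_occ4_val n s (p : 'S_n.+3) : s = v132_4 \/ s = v142_3 ->
  starts s p = [exists v : 'I_n.+3,
    [&& (p ord0 < p (inord 2))%N, (p (inord 2) < p (inord 1))%N
      & if blocks s == blocks v132_4 then (p (inord 1) < v)%N
        else (p (inord 2) < v < p (inord 1))%N]].
Proof.
move/starts_occ4->; apply/existsP/existsP => [[l /and4P[_ h0 h1 h2]]|[v]].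
  by exists (p l); rewrite h0 h1.
case/and3P=> h0 h1 h2; have vE : p (p^-1 v)%g = v by rewrite permKV.
exists (p^-1 v)%g; rewrite /occ4 h0 h1 vE h2 !andbT ltnNge; apply/negP=> le_l2.
have : (p^-1 v)%g \in [:: ord0; inord 1; inord 2].
  rewrite !inE -!val_eqE /= !inordK //; lia.
rewrite !inE => /or3P[] /eqP eq_l; move: h2;
  by rewrite -{}vE eq_l; case: ifP => _; lia.
Qed.

Lemma starts_lift_perm2 n s (a : 'I_n.+3) (b : 'I_n.+2) (r : 'S_n.+1) :
    s = v132_4 \/ s = v142_3 -> (r ord0 < b)%N ->
  starts s (lift_perm ord0 a (lift_perm ord0 b r)) =
  (a <= r ord0)%N && (b != peak s n (r ord0) :> nat).
Proof.
move=> hs; rewrite starts_occ4_val // inord1 inord2 !(lift_perm_lift, lift_perm_id).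
rewrite /peak; set c := r ord0; move: (ltn_ord a) (ltn_ord b) (ltn_ord c) => ha hb hc hcb.
apply/existsP/andP => [[v]|[]].
  by have := ltn_ord v; rewrite /= /bump; case: ifP => _; lia.
(* Here [a <= c < b], so the second and third values, counted from 0, are [b.+1] and [c.+1]. The
   largest value completes 132-4; the value just above the third completes 142-3. *)
case: ifP => [_|_] h1 h2; first exists ord_max; last exists (inord c.+2);
  rewrite /= /bump ?inordK; lia.
Qed.

Lemma starts_contains n s (p : 'S_n) : starts s p -> contains s p.
Proof. by case/existsP=> i /andP[occ _]; apply/existsP; exists i. Qed.

(** Both patterns begin with an ascent inside their first block, so a word starting with a descent
    has no occurrence at its first letter. *)
Lemma starts_letters n s (p : 'S_n.+2) : s = v132_4 \/ s = v142_3 ->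
  starts s p -> (letter1 p < letter2 p)%N.
Proof.
move=> hs sp; have : (pat_size s <= n.+2)%N by apply/contains_size/starts_contains/sp.
rewrite (_ : pat_size s = 4); last by case: hs => ->.
case: n p sp => // n p; rewrite starts_occ4_val // => /existsP[v /and3P[]].
by rewrite /letter1 /letter2; lia.
Qed.

(** The first two letters of [q] play the descent 32 or 42 of the first block; hence a letter put
    before an ascent starts no occurrence. *)
Lemma starts_letters_lift n s (a : 'I_n.+3) (q : 'S_n.+2) :
    s = v132_4 \/ s = v142_3 ->
  starts s (lift_perm ord0 a q) -> (letter2 q < letter1 q)%N.
Proof.
move=> hs; rewrite starts_occ4_val // => /existsP[v /and3P[_ + _]].
rewrite inord1 inord2 !lift_perm_lift ltn_lift.
by rewrite /letter1 /letter2 inord1.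
Qed.

(** * Coefficients of the generating functions and of the operators *)

Lemma Av_small n s : (n < pat_size s)%N -> Av n s = setT.
Proof.
move=> lt_n; apply/setP=> p; rewrite !inE; apply: contraL lt_n => /contains_size.
by rewrite -leqNgt.
Qed.

Lemma letters_neq n (p : 'S_n.+2) : letter1 p != letter2 p.
Proof.
by rewrite /letter1 /letter2 inord1 eqSS (inj_eq val_inj) (inj_eq perm_inj).
Qed.

Lemma F_atS s n : s = v132_4 \/ s = v142_3 ->
  F s n.+1 = \sum_(p in Av n.+1 s) 'X^((p ord0).+1).
Proof.
move=> hs; rewrite /F /F1 /F2 /zx_mon /=; case: n => [|n] /=.
  rewrite Av_small; last by case: hs => ->.
  by rewrite (big_pred1 1%g) ?perm1 ?addr0 // => p; rewrite inE; apply/esym/eqP/permS1.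
rewrite mulr0n add0r.
rewrite [RHS](bigID (fun p : 'S_n.+2 => (letter2 p < letter1 p)%N)) /=.
congr (_ + _); apply: eq_bigl => p; rewrite -leqNgt [in RHS]leq_eqVlt.
by rewrite (negPf (letters_neq p)).
Qed.

Lemma F_at0 s : F s 0 = 0.
Proof. by rewrite /F /F1 /F2 /zx_mon /= mulr0n !addr0. Qed.

Lemma mon_extendF k h s n : s = v132_4 \/ s = v142_3 ->
  mon_extend k h (F s) (n.+1 + k) =
  \sum_(p in Av n.+1 s) h n.+1 (p ord0).+1.
Proof.
move=> hs; rewrite /mon_extend leq_addl addnK F_atS //.
exact: (polysum_linear_ext _ (fun p : 'S_n.+1 => (p ord0).+1) (h n.+1)).
Qed.

Lemma mon_extend_eq0 k h f n : ((k <= n)%N -> f (n - k)%N = 0) ->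
  mon_extend k h f n = 0.
Proof. by rewrite /mon_extend; case: leqP => // _ -> //; rewrite size_poly0 big_ord0. Qed.

(** Converts values counted from 0 into exponents of x, which count from 1. *)
Lemma sum_shift (V : nmodType) m n k (f : nat -> V) : (n <= k)%N ->
  \sum_(a < k | (m <= a < n)%N) f a.+1 = \sum_(m.+1 <= a < n.+1) f a.
Proof.
move=> le_nk; rewrite big_add1 /= (big_nat_widen _ _ _ _ _ le_nk) /=.
rewrite (big_nat_widenl _ 0) // big_mkord; apply: eq_bigl => a /=; lia.
Qed.

(** A new first letter above that of [q] creates a descent, hence no occurrence; every avoider [q]
    contributes, whether it starts with an ascent or a descent. *)
Lemma F1_rec s n : s = v132_4 \/ s = v142_3 ->
  F1 s n.+2 = P21 (F s) n.+2.
Proof.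
move=> hs; rewrite /P21 -[in RHS](addn1 n.+1) mon_extendF //.
rewrite /F1 /zx_mon /= mulr0n add0r big_lift_perm [RHS]big_mkcond.
apply: eq_bigr => q _; rewrite -(@sum_shift _ _ _ n.+2) //.
case: ifP => Aq; last first.
  by rewrite big_pred0 // => a; rewrite Av_lift_perm Aq.
apply: eq_big => a; last by rewrite letter1_lift.
rewrite Av_lift_perm Aq /= letter1_lift letter2_lift.
case: (boolP (starts _ _)) => [/(starts_letters hs)|_] /=;
  rewrite ?letter1_lift ?letter2_lift /bump; have := ltn_ord a; lia.
Qed.

Lemma peak_bounds s n c : (c <= n)%N -> (c < peak s n c < n.+2)%N.
Proof. by rewrite /peak; case: ifP => _; lia. Qed.

(** Split by the second and third letters: an ascent gives [P123]; a descent calls for a second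
    deletion and gives [P132] and [P231]. Size at least 3 keeps the remaining word nonempty. *)
Lemma F2_rec s n : s = v132_4 \/ s = v142_3 ->
  F2 s n.+3 = P132 (F s) n.+3 + P231 (F s) n.+3 + P123 (F2 s) n.+3.
Proof.
move=> hs; rewrite [F2 s n.+3]/F2 big_lift_perm.
pose asc := fun q : 'S_n.+2 => (letter1 q < letter2 q)%N.
rewrite (bigID asc) /= addrC; congr (_ + _); last first.
  rewrite /P123 /mon_extend subSS subn0 /F2 /=.
  rewrite (polysum_linear_ext
    (fun q => (q \in Av n.+2 s) && (letter1 q < letter2 q)%N) (@letter1 n)
    (fun b => \sum_(1 <= a < b.+1) 'X^a)).
  rewrite big_mkcond [RHS]big_mkcond /=; apply: eq_bigr => q _.
  rewrite {}/asc; case: ifP => ltq; last by rewrite andbF.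
  rewrite andbT -(@sum_shift _ _ _ n.+3) //; last exact: leqW (ltn_ord _).
  case: ifP => Aq; last by rewrite big_pred0 // => a; rewrite Av_lift_perm Aq.
  apply: eq_big => a; last by rewrite letter1_lift.
  rewrite Av_lift_perm Aq /= letter1_lift letter2_lift.
  case: (boolP (starts _ _)) => [/(starts_letters_lift hs)|_] /=; first by lia.
  by rewrite /letter1 /bump; lia.
rewrite /P132 /P231 -[in RHS](addn2 n.+1) !mon_extendF // -big_split /=.
rewrite big_lift_perm [RHS]big_mkcond.
apply: eq_bigr => r _; set c := r ord0; have := ltn_ord c => lt_c.
(* For an avoider [r] and [c < b], this is the condition for prepending [b] and then [a] to give an
   avoider with an initial ascent: [a <= b] is the ascent, and [a <= c] means an initial 132, which
   forces [b]. *)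
pose K (a b : nat) := (a <= b)%N && ((a <= c)%N ==> (b == peak s n c)).
transitivity (if r \in Av n.+1 s then
    \sum_(b < n.+2 | (c < b)%N) \sum_(a < n.+3 | K a b) 'X^(a.+1) else 0 : {poly rat}).
  case: ifP => Ar; last first.
    rewrite big1 // => b _; rewrite big_pred0 // => a.
    by rewrite !Av_lift_perm Ar.
  apply: eq_big => [b|b]; rewrite /asc letter1_lift letter2_lift -/c.
    by rewrite /bump; lia.
  move=> le_cb; have lt_cb : (c < b)%N by move: le_cb; rewrite /bump; lia.
  apply: eq_big => a; last by rewrite letter1_lift.
  rewrite !Av_lift_perm Ar starts_lift_perm2 // letter1_lift letter2_lift.
  have -> : starts s (lift_perm ord0 b r) = false.
    apply: contraNF le_cb => /(starts_letters hs); by rewrite letter1_lift letter2_lift.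
  by rewrite lift_perm_id /K -/c /bump; lia.
case: ifP => // _; have /andP[lt_cp lt_pn] := peak_bounds s (lt_c : c <= n)%N.
(* The part [a <= c] starts with 132 and becomes the [P132] term; the rest starts with 231. *)
under [LHS]eq_bigr => b _ do rewrite (bigID (fun a : 'I_n.+3 => (a <= c)%N)) /=.
rewrite big_split /=; congr (_ + _).
  rewrite (exchange_big_dep (fun a : 'I_n.+3 => (a <= c)%N)) /=; last by move=> b a _ /andP[].
  rewrite -(@sum_shift _ 0 c.+1 n.+3) //; last by lia.
  apply: eq_big => // a le_ac; rewrite (big_pred1 (Ordinal lt_pn)) // => b.
  by rewrite /= -val_eqE /= /K; lia.
rewrite (exchange_big_dep (fun a : 'I_n.+3 => (c.+1 <= a < n.+2)%N)) /=; last first.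
  by move=> b a _; rewrite /K; have := ltn_ord b; lia.
rewrite -(@sum_shift _ _ _ n.+3) //; apply: eq_bigr => a /andP[lt_ca lt_an].
rewrite (eq_bigl (fun b : 'I_n.+2 => (a <= b < n.+2)%N)); last first.
  by move=> b /=; rewrite /K; have := ltn_ord b; lia.
(* The monomial is constant in [b], and both ranges of [b] have [n.+2 - a] elements. *)
by rewrite (@sum_shift _ _ _ _ (fun=> 'X^(a.+1))) // !sumr_const_nat !subSS.
Qed.

Theorem theorem4p3 (s : vincular) (hs : s = v132_4 \/ s = v142_3) :
  F1 s =1 zx_mon 1 1 \+ P21 (F s) /\
  F2 s =1 zx_mon 2 1 \+ P132 (F s) \+ P231 (F s) \+ P123 (F2 s).
Proof.
split; case=> [|[|n]].
- by rewrite /= [P21 _ _]mon_extend_eq0.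
- by rewrite /= [P21 _ _]mon_extend_eq0 ?F_at0 // /F1 /= addr0.
- by rewrite F1_rec // /= /zx_mon mulr0n add0r.
- by rewrite /P132 /P231 /P123 /= !mon_extend_eq0 // !addr0.
- by rewrite /P132 /P231 /P123 /= !mon_extend_eq0 // !addr0.
case: n => [|n]; last by rewrite F2_rec // /= /zx_mon mulr0n add0r.
(* In degree 2 the operators contribute nothing, and 12 is the only permutation with an ascent. *)
rewrite /P132 /P231 /P123 /= !mon_extend_eq0 ?F_at0 // !addr0 /F2 /zx_mon /=.
rewrite big_lift_perm (big_pred1 1%g) => [|q]; last by apply/esym/eqP/permS1.
rewrite (big_pred1 ord0) ?letter1_lift // => a.
rewrite Av_small ?inE; last by case: hs => ->.
by rewrite letter1_lift letter2_lift perm1 -val_eqE /bump /=; lia.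
Qed.
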